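(* Let $m,m'\in\mathbb N_0$, let $q\in\mathbb C$ with $0<|q|<1$, let $a,b,c,d\in\mathbb C\setminus\{0\}$, and let $t\in\mathbb C$ be such that $|bdt|<1$, where the parameters are such that no denominator below vanishes. Then $$\sum_{n=0}^\infty \frac{q^{2\binom n2}t^n}{(q,\frac1{cd};q)_n}\,Q_n[q^{-m}a;a,b|q^{-1}]\,Q_n[q^{-m'}c;c,d|q^{-1}]$$ $$=q^{-\binom m2}q^{-\binom{m'}2}\left(-\frac{c}{qd}\right)^{m'}\left(-\frac{adt}{q}\right)^m\frac{(\frac{dt}{a};q)_\infty}{(bdt;q)_\infty}\,\frac{(\frac{q}{adt};q)_m}{(\frac{dt}{a};q)_m}\,\frac{(\frac{qd}{c};q)_{m'}}{(\frac1{cd};q)_{m'}}\;{}_4\phi_3\!\left(\begin{matrix}q^{-m'},\frac{q^{m'}}{c^2},adt,bdt\\ q^{-m}adt,\,q^m\frac{dt}{a},\,\frac{qd}{c}\end{matrix};q,q\right).$$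
   Context: $(a;q)_n=\prod_{j=0}^{n-1}(1-aq^j)$ for $n\in\mathbb N_0=\{0,1,2,\dots\}$, $(a;q)_\infty=\lim_{n\to\infty}(a;q)_n$, and $(a_1,\dots,a_k;q)_n=\prod_{i}(a_i;q)_n$. The basic hypergeometric series is ${}_r\phi_s\!\left(\begin{matrix}a_1,\dots,a_r\\ b_1,\dots,b_s\end{matrix};q,z\right)=\sum_{k\ge0}\frac{(a_1,\dots,a_r;q)_k}{(q,b_1,\dots,b_s;q)_k}\big((-1)^kq^{\binom k2}\big)^{1+s-r}z^k$, with $b_j\notin\{q^{-k}:k\in\mathbb N_0\}$. The $q^{-1}$-Al-Salam--Chihara polynomials are, for $x=\frac12(z+z^{-1})$, $$Q_n(x;a,b|q^{-1})=q^{-\binom n2}(-b)^n\left(\tfrac1{ab};q\right)_n\,{}_3\phi_1\!\left(\begin{matrix}q^{-n},\frac{z}{a},\frac{1}{az}\\ \frac1{ab}\end{matrix};q,\frac{q^na}{b}\right),$$ and $Q_n[w;a,b|q^{-1}]$ denotes $Q_n(x;a,b|q^{-1})$ evaluated at $x=\frac12(w+w^{-1})$. *)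

(* Defs.v *)
From HB Require Import structures.
From mathcomp Require Import all_boot all_order all_algebra.
From mathcomp Require Import all_classical all_reals all_analysis.
From mathcomp Require Import complex ring.

Set Implicit Arguments.
Unset Strict Implicit.
Unset Printing Implicit Defensive.

Import Order.TTheory GRing.Theory Num.Theory.
Import numFieldNormedType.Exports.

Local Open Scope classical_set_scope.
Local Open Scope ring_scope.

(* The topology that the analysis library puts on a numFieldType is found by
   unification only when the carrier is displayed as the sort of such a
   structure; hence this name for R[i]. *)
Definition Cplx (R : realType) : numClosedFieldType := R[i].

Section QSeries.
Variable C : numClosedFieldType.
Implicit Types (a b q x z w : C) (aa bb : seq C) (n k : nat).

Definition qpoch a q n : C := \prod_(0 <= j < n) (1 - a * q ^+ j).

Definition qpoch_infty a q : C := limn (fun n => qpoch a q n).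

Definition qpochs aa q n : C := \prod_(a <- aa) qpoch a q n.

(* The exponent 1 + s - r is an integer, possibly negative. *)
Definition qhyper_term aa bb q z k : C :=
  qpochs aa q k / qpochs (q :: bb) q k
  * ((-1) ^+ k * q ^+ 'C(k, 2)) ^ (1 + (size bb)%:Z - (size aa)%:Z)
  * z ^+ k.

Definition qhyper aa bb q z : C := limn (series (qhyper_term aa bb q z)).

Definition qhyper_lower_ok q b : Prop := forall k, b <> q ^- k.

Definition qinvASC_z n z a b q : C :=
  q ^- 'C(n, 2) * (- b) ^+ n * qpoch (a * b)^-1 q n
  * qhyper [:: q ^- n; z / a; (a * z)^-1] [:: (a * b)^-1] q (q ^+ n * a / b).

(* As a function of x = (z + z^-1) / 2, through one of the two roots z; the
   other root is z^-1, and by qinvASC_zV both give the same value. *)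
Definition qinvASC n x a b q : C := qinvASC_z n (x + sqrtC (x ^+ 2 - 1)) a b q.

Definition qinvASC_at n w a b q : C := qinvASC n ((w + w^-1) / 2) a b q.

Lemma qinvASC_zV n z a b q : qinvASC_z n z^-1 a b q = qinvASC_z n z a b q.
Proof.
rewrite /qinvASC_z; congr (_ * _).
rewrite /qhyper; congr (limn (series _)).
apply/funext => k; rewrite /qhyper_term /qpochs !big_cons !big_nil.
have -> : z^-1 / a = (a * z)^-1 by rewrite invfM mulrC.
have -> : (a * z^-1)^-1 = z / a by rewrite invfM invrK mulrC.
by congr (_ * _ / _ * _ * _); rewrite mulrCA.
Qed.

Lemma qinvASC_atE n w a b q :
  w != 0 -> qinvASC_at n w a b q = qinvASC_z n w a b q.
Proof.
move=> w0; rewrite /qinvASC_at /qinvASC.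
set x := (w + w^-1) / 2; set s := sqrtC _.
have : (x + s - w) * (x + s - w^-1) = 0.
  have s2 : s ^+ 2 = x ^+ 2 - 1 by rewrite sqrtCK.
  have xE : w + w^-1 = 2 * x by rewrite /x mulrC divfK// pnatr_eq0.
  have ww : w * w^-1 = 1 by rewrite mulfV.
  transitivity (x ^+ 2 + 2 * x * s + s ^+ 2 - (w + w^-1) * (x + s)
                + w * w^-1); first by ring.
  by rewrite s2 xE ww; ring.
move/eqP; rewrite mulf_eq0 !subr_eq0 => /orP[]/eqP-> //.
exact: qinvASC_zV.
Qed.

End QSeries.

(* Main.v *)
Require Import Defs.
From mathcomp Require Import all_boot all_order all_algebra.
From mathcomp Require Import all_classical all_reals all_analysis.
From mathcomp Require Import complex.
From mathcomp Require Import ring zify.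

Import Order.TTheory GRing.Theory Num.Theory.
Import numFieldNormedType.Exports.

Local Open Scope classical_set_scope.
Local Open Scope ring_scope.

(* At [z = q^-m a] the [3phi1] in [Q_n] terminates after [m + 1] terms, and is a
   polynomial in [X = q^n].  The second factor is rewritten as a little q-Jacobi
   polynomial, i.e. expanded in the powers [q^(n i)], [i <= m'].  The factor
   [q^(n i)] only replaces [t] by [t q^i], so the left-hand side becomes a
   finite combination over [i] of values of the generating function
   sum_n (b d t)^n (1/(ab);q)_n / (q;q)_n * 3phi1(q^-n, q^-m, q^m/a^2; 1/(ab)).
   Expanding this [3phi1] and summing over [n] first by the q-binomial theorem
   leaves a terminating [2phi1] that q-Chu-Vandermonde sums to a product; the
   sum over [i] is then the [4phi3]. *)

(** * q-binomial coefficients and q-Chu-Vandermonde sums *)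

Lemma bin2_add_sub m j : (j <= m)%N ->
  ('C(m, 2) = 'C(j, 2) + 'C(m - j, 2) + j * (m - j))%N.
Proof.
move=> /subnKC; move: (m - j)%N => k <-.
elim: k => [|k IHk]; first by rewrite muln0 !addn0.
by rewrite addnS !binS !bin1 IHk; lia.
Qed.

Lemma sqrn_bin2 j : (j * j = 'C(j, 2) + 'C(j, 2) + j)%N.
Proof. by elim: j => [|j IHj] //; rewrite binS bin1; lia. Qed.

Section QBinomial.
Variables (C : numClosedFieldType) (q : C).
Implicit Types (a b c B D x y X : C) (f : nat -> C).

Lemma qpoch0 a : qpoch a q 0 = 1.
Proof. by rewrite /qpoch big_geq. Qed.

Lemma qpochS a n : qpoch a q n.+1 = (1 - a) * qpoch (a * q) q n.
Proof.
rewrite /qpoch big_nat_recl // expr0 mulr1; congr (_ * _).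
by apply: eq_bigr => i _; rewrite exprS mulrA.
Qed.

Lemma qpochSr a n : qpoch a q n.+1 = qpoch a q n * (1 - a * q ^+ n).
Proof. by rewrite /qpoch big_nat_recr. Qed.

Lemma qpochD a m n : qpoch a q (m + n) = qpoch a q m * qpoch (a * q ^+ m) q n.
Proof.
elim: n => [|n IHn]; first by rewrite addn0 qpoch0 mulr1.
by rewrite addnS !qpochSr IHn exprD !mulrA.
Qed.

Lemma qpoch_neq0P a n :
  reflect (forall k, (k < n)%N -> a * q ^+ k != 1) (qpoch a q n != 0).
Proof.
rewrite /qpoch big_mkord prodf_seq_neq0; apply: (iffP allP) => /= H.
  move=> k kn; have := H (Ordinal kn) (mem_index_enum _).
  by rewrite subr_eq0 eq_sym.
by move=> i _; rewrite subr_eq0 eq_sym H.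
Qed.

Lemma qpoch_lower_ok_neq0 a :
  q != 0 -> qhyper_lower_ok q a -> forall n, qpoch a q n != 0.
Proof.
move=> q0 aok n; apply/qpoch_neq0P => k _; apply/eqP => ak; apply: (aok k).
by apply: (mulIf (expf_neq0 k q0)); rewrite ak mulVf // expf_neq0.
Qed.

Hypothesis q_neq0 : q != 0.
Hypothesis qq_neq0 : forall n, qpoch q q n != 0.

(** The value 0 for [k > n] lets Pascal's rule be summed over a full range without separate boundary
    terms. *)
Definition qbin n k : C :=
  if (k <= n)%N then qpoch q q n / (qpoch q q k * qpoch q q (n - k)) else 0.

Lemma qbinn0 n : qbin n 0 = 1.
Proof. by rewrite /qbin leq0n subn0 qpoch0 mul1r divff. Qed.

Lemma qbin_small n k : (n < k)%N -> qbin n k = 0.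
Proof. by move=> nk; rewrite /qbin leqNgt nk. Qed.

Lemma qbinSl n k : qbin n.+1 k.+1 = q ^+ k.+1 * qbin n k.+1 + qbin n k.
Proof.
rewrite /qbin ltnS subSS; have [kn|nk|->] := ltngtP k n.
- have -> : (n - k = (n - k.+1).+1)%N by rewrite subnSK.
  rewrite !qpochSr.
  have := qq_neq0 n; have := qq_neq0 k.+1; have := qq_neq0 (n - k.+1).+1.
  rewrite !qpochSr !mulf_eq0 !negb_or => /andP[h1 h2] /andP[h3 h4] h5.
  have -> : q ^+ n = q ^+ (n - k.+1) * q ^+ k * q.
    by rewrite -exprD -exprSr; congr (_ ^+ _); lia.
  rewrite exprS; field.
  by rewrite h1 h2 h3 h4.
- by rewrite mulr0 add0r.
- by rewrite subnn qpoch0 mulr0 add0r !mulr1 !divff.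
Qed.

Lemma qbinSr n k : (k <= n)%N ->
  qbin n.+1 k.+1 = qbin n k.+1 + q ^+ (n - k) * qbin n k.
Proof.
rewrite /qbin ltnS subSS; have [kn _|//|-> _] := ltngtP k n; last first.
  by rewrite subnn qpoch0 expr0 !mulr1 mul1r add0r !divff.
have -> : (n - k = (n - k.+1).+1)%N by rewrite subnSK.
rewrite !qpochSr.
have := qq_neq0 n; have := qq_neq0 k.+1; have := qq_neq0 (n - k.+1).+1.
rewrite !qpochSr !mulf_eq0 !negb_or => /andP[h1 h2] /andP[h3 h4] h5.
have -> : q ^+ n = q ^+ (n - k.+1) * q ^+ k * q.
  by rewrite -exprD -exprSr; congr (_ ^+ _); lia.
rewrite exprS; field.
by rewrite h1 h2 h3 h4.
Qed.

(** Pascal's rule in summed form. With its mirror image [sum_qbinSr], it reduces the inductions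
    below to comparing summands for a fixed [k]. *)
Lemma sum_qbinSl n f :
  \sum_(k < n.+2) qbin n.+1 k * f k =
  \sum_(k < n.+1) qbin n k * (q ^+ k * f k + f k.+1).
Proof.
rewrite big_ord_recl /= qbinn0.
under eq_bigr => i _ do rewrite /bump /= add1n qbinSl mulrDl.
rewrite big_split /= big_ord_recr /= qbin_small // mulr0 mul0r addr0 addrA.
under [in RHS]eq_bigr => i _ do rewrite mulrDr.
rewrite [in RHS]big_split /=; congr (_ + _).
rewrite [in RHS]big_ord_recl /= qbinn0 expr0 !mul1r; congr (_ + _).
by apply: eq_bigr => i _; rewrite /bump /= add1n mulrCA mulrA.
Qed.

Lemma sum_qbinSr n f :
  \sum_(k < n.+2) qbin n.+1 k * f k =
  \sum_(k < n.+1) qbin n k * (f k + q ^+ (n - k) * f k.+1).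
Proof.
rewrite big_ord_recl /= qbinn0.
under eq_bigr => i _ do rewrite /bump /= add1n qbinSr -1?ltnS // mulrDl.
rewrite big_split /= big_ord_recr /= qbin_small // mul0r addr0 addrA.
under [in RHS]eq_bigr => i _ do rewrite mulrDr.
rewrite [in RHS]big_split /=; congr (_ + _).
  by rewrite [in RHS]big_ord_recl /= qbinn0.
by apply: eq_bigr => i _; rewrite mulrCA mulrA.
Qed.

(** Both products are the q-trinomial coefficient of [j], [k] and [n - j - k]. The right side
    isolates the dependence on [k] once two sums are exchanged. *)
Lemma qbin_trinomial n k j : (j <= n)%N ->
  qbin n (j + k) * qbin (j + k) j = qbin n j * qbin (n - j) k.
Proof.
move=> jn; rewrite /qbin jn leq_addr -leq_subRL // addKn subnDA.
case: leqP => [kn|nk]; last by rewrite mul0r mulr0.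
have := qq_neq0 j; have := qq_neq0 k; have := qq_neq0 (j + k).
have := qq_neq0 (n - j); have := qq_neq0 (n - j - k).
by move=> h1 h2 h3 h4 h5; field; rewrite h1 h2 h3 h4 h5.
Qed.

(* The q-Chu-Vandermonde sum with argument [c q^m / b], where [c = b y], cleared
   of denominators. *)
Lemma q_vandermonde m b y :
  \sum_(k < m.+1) qbin m k *
    ((-1) ^+ k * q ^+ 'C(k, 2) * y ^+ k * qpoch b q k
      * qpoch (b * y * q ^+ k) q (m - k)) = qpoch y q m.
Proof.
elim: m y => [|m IHm] y.
  by rewrite big_ord1 qbinn0 !qpoch0 !expr0 !mulr1.
(* The bracket [(1 - b y q^k) - y (1 - b q^k)] produced by Pascal's rule is [1 - y], so the
   induction hypothesis applies at [y * q]. *)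
rewrite (sum_qbinSl _ (fun k => (-1) ^+ k * q ^+ 'C(k, 2) * y ^+ k * qpoch b q k
      * qpoch (b * y * q ^+ k) q (m.+1 - k))) qpochS -IHm mulr_sumr.
apply: eq_bigr => -[k /= km] _; rewrite [RHS]mulrCA; congr (_ * _).
rewrite subSS subSn // qpochS qpochSr binS bin1 !exprD !exprS exprMn.
have -> : b * y * q ^+ k * q = b * (y * q) * q ^+ k by ring.
have -> : b * y * (q * q ^+ k) = b * (y * q) * q ^+ k by ring.
by ring.
Qed.

(* The q-Chu-Vandermonde sum with argument [q], cleared of denominators. *)
Lemma q_vandermonde_rev m b c :
  \sum_(k < m.+1) qbin m k *
    ((-1) ^+ k * q ^+ 'C(m - k, 2) * qpoch b q k
      * qpoch (c * q ^+ k) q (m - k))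
  = q ^+ 'C(m, 2) * \prod_(l < m) (b - c * q ^+ l).
Proof.
elim: m c => [|m IHm] c.
  by rewrite big_ord1 big_ord0 qbinn0 !qpoch0 !expr0 !mulr1.
rewrite (sum_qbinSr _ (fun k => (-1) ^+ k * q ^+ 'C(m.+1 - k, 2) * qpoch b q k
      * qpoch (c * q ^+ k) q (m.+1 - k))).
(* Here the bracket is [(1 - c q^k) - (1 - b q^k) = q^k (b - c)]. The missing [q^(m-k)] comes from
   the exponent ['C(m.+1 - k, 2)], and [c] moves to [c * q]. *)
transitivity (q ^+ m * (b - c) * \sum_(k < m.+1) qbin m k *
    ((-1) ^+ k * q ^+ 'C(m - k, 2) * qpoch b q k
      * qpoch (c * q * q ^+ k) q (m - k))).
  rewrite mulr_sumr; apply: eq_bigr => -[k /= km] _.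
  rewrite [RHS]mulrCA; congr (_ * _).
  rewrite subSS subSn // qpochS qpochSr binS bin1 !exprD !exprS.
  have -> : q ^+ m = q ^+ (m - k) * q ^+ k by rewrite -exprD subnK.
  have -> : c * q ^+ k * q = c * q * q ^+ k by ring.
  have -> : c * (q * q ^+ k) = c * q * q ^+ k by ring.
  by ring.
rewrite IHm big_ord_recl /= binS bin1 exprD expr0 mulr1.
under [in RHS]eq_bigr => i _ do rewrite /bump /= add1n exprS mulrA.
by ring.
Qed.

(** A q-analogue of the falling factorial: at [X = q^n] it is
    [(1 - q^n)(1 - q^(n-1))...(1 - q^(n-k+1))], which vanishes for [n < k]. *)
Definition qfall X k : C := \prod_(0 <= l < k) (1 - X * q ^- l).

Lemma qfallS X k : qfall X k.+1 = qfall X k * (1 - X * q ^- k).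
Proof. by rewrite /qfall big_nat_recr. Qed.

(** Change of basis from powers to falling factors. Multiplying the [j]-th falling term by [X] gives
    [q^j] times that term plus the next one, which is the shape of [sum_qbinSl]. *)
Lemma expr_qfall X i :
  X ^+ i = \sum_(j < i.+1) qbin i j * ((-1) ^+ j * q ^+ 'C(j, 2) * qfall X j).
Proof.
elim: i => [|i IHi].
  by rewrite big_ord1 qbinn0 /qfall big_geq // !mulr1.
rewrite (sum_qbinSl _ (fun j => (-1) ^+ j * q ^+ 'C(j, 2) * qfall X j)).
rewrite exprS IHi mulr_sumr; apply: eq_bigr => -[j /= ji] _.
rewrite [LHS]mulrCA; congr (_ * _).
rewrite qfallS binS bin1 exprD exprS.
have := expf_neq0 j q_neq0; move: (q ^+ j) => Q Q0.
by field.
Qed.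

(** Each power of [X] is expanded by [expr_qfall] and the sums are exchanged; the inner sum is then
    [q_vandermonde_rev] with [B] and [D] shifted by [q^j]. *)
Lemma sum_qbin_qfall M B D X :
  \sum_(i < M.+1) qbin M i * ((-1) ^+ i * q ^+ 'C(M - i, 2) * qpoch B q i
      * qpoch (D * q ^+ i) q (M - i) * X ^+ i)
  = q ^+ 'C(M, 2) * \sum_(j < M.+1) qbin M j *
      (qpoch B q j * qfall X j * \prod_(l < M - j) (B - D * q ^+ l)).
Proof.
transitivity (\sum_(i < M.+1) \sum_(j < M.+1) qbin M i * qbin i j *
    ((-1) ^+ i * q ^+ 'C(M - i, 2) * qpoch B q i
      * qpoch (D * q ^+ i) q (M - i) *
      ((-1) ^+ j * q ^+ 'C(j, 2) * qfall X j))).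
  apply: eq_bigr => -[i /= iM] _; rewrite (expr_qfall X).
  rewrite (big_ord_widen M.+1 (fun j => qbin i j *
      ((-1) ^+ j * q ^+ 'C(j, 2) * qfall X j))) // big_mkcond /=.
  rewrite !mulr_sumr; apply: eq_bigr => -[j /= jM] _.
  case: ltnP => [_|ij]; last by rewrite (qbin_small _ _ ij) !mulr0 mul0r.
  by ring.
rewrite exchange_big mulr_sumr; apply: eq_bigr => -[j /= jM] _.
rewrite ltnS in jM.
pose F i := qbin M i * qbin i j *
    ((-1) ^+ i * q ^+ 'C(M - i, 2) * qpoch B q i
      * qpoch (D * q ^+ i) q (M - i) *
      ((-1) ^+ j * q ^+ 'C(j, 2) * qfall X j)).
(* The terms with [i < j] vanish; the others are reindexed by [k = i - j]. *)
rewrite -(big_mkord xpredT F) (@big_cat_nat _ _ _ j) //=; last exact: leqW.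
rewrite [X in X + _]big_nat_cond big1 ?add0r; last first.
  move=> i; rewrite andbT => /andP[_ ij].
  by rewrite /F (qbin_small _ _ ij) mulr0 mul0r.
rewrite -{1}[j]add0n big_addn subSn // big_mkord.
transitivity (qbin M j * (q ^+ 'C(j, 2) * qpoch B q j * qfall X j *
   \sum_(k < (M - j).+1) qbin (M - j) k * ((-1) ^+ k * q ^+ 'C(M - j - k, 2)
     * qpoch (B * q ^+ j) q k * qpoch (D * q ^+ j * q ^+ k) q (M - j - k)))).
  rewrite !mulr_sumr; apply: eq_bigr => k _.
  rewrite /F addnC qbin_trinomial // !subnDA qpochD !exprD !mulrA.
  have e : (-1) ^+ j * (-1) ^+ j = 1 :> C by rewrite -expr2 sqrr_sign.
  by rewrite -[RHS]mul1r -[X in _ = X * _]e; ring.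
rewrite q_vandermonde_rev (bin2_add_sub M j) // !exprD exprM.
(* The extracted [q^(j(M-j))] is the cross term of [bin2_add_sub]. *)
have -> : \prod_(l < M - j) (B * q ^+ j - D * q ^+ j * q ^+ l) =
   q ^+ j ^+ (M - j) * \prod_(l < M - j) (B - D * q ^+ l).
  under eq_bigr => l _.
    have -> : B * q ^+ j - D * q ^+ j * q ^+ l = q ^+ j * (B - D * q ^+ l).
      by ring.
    over.
  by rewrite big_split /= prodr_const card_ord.
by ring.
Qed.

End QBinomial.

(** * The terminating series *)

Section Terminating.
Variables (C : numClosedFieldType) (q : C).
Implicit Types (a b c e u B D x y X : C) (f : nat -> C).
Hypothesis q_neq0 : q != 0.
Hypothesis qq_neq0 : forall n, qpoch q q n != 0.

Lemma qpoch_expVn_eq0 m k : (m < k)%N -> qpoch (q ^- m) q k = 0.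
Proof.
move=> mk; apply/eqP; apply: contraT => /qpoch_neq0P /(_ _ mk).
by rewrite mulVf ?eqxx // expf_neq0.
Qed.

Lemma qpoch_expVn m k : (k <= m)%N ->
  qpoch (q ^- m) q k = qbin _ q m k * qpoch q q k
    * ((-1) ^+ k * q ^+ 'C(k, 2) * q ^- m ^+ k).
Proof.
move=> km; rewrite /qbin km.
have -> : qpoch q q m / (qpoch q q k * qpoch q q (m - k)) * qpoch q q k
  = qpoch q q m / qpoch q q (m - k).
  by have := qq_neq0 k; have := qq_neq0 (m - k) => h1 h2; field; rewrite h1 h2.
elim: k km => [|k IHk] km.
  by rewrite subn0 !qpoch0 divff // !mulr1.
rewrite qpochSr IHk 1?ltnW // binS bin1.
have -> : (m - k = (m - k.+1).+1)%N by rewrite subnSK.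
have := qq_neq0 (m - k.+1).+1.
rewrite !exprS exprD qpochSr mulf_eq0 negb_or -exprS => /andP[h1 h2].
have Em : q ^+ m = q ^+ (m - k.+1) * q ^+ k * q.
  by rewrite -exprD -exprSr; congr (_ ^+ _); lia.
have h3 := expf_neq0 k q_neq0; have h4 := expf_neq0 (m - k.+1) q_neq0.
rewrite Em; move: h1 h2 h3 h4; rewrite exprS.
move: (qpoch q q m) (qpoch q q _) (q ^+ (m - _)) (q ^+ k) (q ^+ 'C(_, _)).
move=> x1 x2 x3 x4 x6 h1 h2 h3 h4.
rewrite -mulrA; set W := (_ ^+ k).
by field; rewrite h1 h2 h3 h4 q_neq0.
Qed.

(** Past index [m] the numerator contains the factor [1 - q^-m q^m], so the partial sums are
    eventually constant. *)
Lemma qhyper_terminating aa bb z m : q ^- m \in aa ->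
  qhyper aa bb q z = \sum_(k < m.+1) qhyper_term aa bb q z k.
Proof.
move=> /path.splitPr [aa1 aa2]; set s := _ ++ _.
have z0 k : (m < k)%N -> qhyper_term s bb q z k = 0.
  move=> mk; rewrite /qhyper_term /s /qpochs big_cat !big_cons.
  by rewrite (qpoch_expVn_eq0 _ _ mk) /= !(mul0r, mulr0).
rewrite /qhyper; apply: cvg_lim; first exact: norm_hausdorff.
rewrite -(cvg_shiftn m.+1) /=.
rewrite [X in X @ _ --> _]
  (_ : _ = cst (\sum_(k < m.+1) qhyper_term s bb q z k)).
  exact: cvg_cst.
apply/funext => n; rewrite /series /= addnC.
rewrite (@big_cat_nat _ _ _ m.+1) //= ?leq_addr //.
rewrite [X in _ + X]big_nat_cond [X in _ + X]big1 ?addr0 ?big_mkord //.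
by move=> i; rewrite andbT => /andP[mi _]; exact: z0.
Qed.

(** [q_vandermonde] in hypergeometric notation. The last factor stands for the quotient of
    [qpoch (B * y) q m] by [qpoch (B * y) q k], without a division. *)
Lemma q_vandermonde_qpoch m B y :
  \sum_(k < m.+1) qpoch (q ^- m) q k * qpoch B q k / qpoch q q k *
    (y * q ^+ m) ^+ k * qpoch (B * y * q ^+ k) q (m - k) = qpoch y q m.
Proof.
rewrite -(q_vandermonde C q q_neq0 qq_neq0 m B y).
apply: eq_bigr => -[k /=]; rewrite ltnS => km _.
rewrite qpoch_expVn // exprMn.
have Wq : q ^- m ^+ k * q ^+ m ^+ k = 1.
  by rewrite -exprMn mulVf ?expf_neq0 // expr1n.
rewrite -[in RHS](mulr1 (y ^+ k)) -Wq.
by have h := qq_neq0 k; field.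
Qed.

(* The [3phi1] in [Q_n] at [z = q ^- m * a], as a polynomial in [X = q ^+ n]. *)
Definition phi31 m B e u X : C :=
  \sum_(k < m.+1) qpoch (q ^- m) q k * qpoch B q k
    / (qpoch q q k * qpoch e q k) * u ^+ k * qfall _ q X k.

(** Explains the polynomial form: the inverse factor [(-1)^k q^'C(k, 2)] of a [3phi1] and the [q^n]
    in its argument combine with [(q^-n;q)_k] into a falling factor. *)
Lemma qfall_expn n k :
  qfall _ q (q ^+ n) k
  = qpoch (q ^- n) q k / ((-1) ^+ k * q ^+ 'C(k, 2)) * q ^+ n ^+ k.
Proof.
elim: k => [|k IHk].
  by rewrite /qfall big_geq // qpoch0 bin0n !expr0 !mulr1 invr1 mulr1.
rewrite qfallS IHk qpochSr binS bin1 !exprS exprD.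
have h1 := expf_neq0 k q_neq0; have h2 := expf_neq0 n q_neq0.
have h3 := expf_neq0 'C(k, 2) q_neq0; have h4 : (-1) ^+ k != 0 :> C.
  by rewrite signr_eq0.
move: h1 h2 h3 h4; set W := q ^+ n ^+ k.
move: W (q ^+ k) (q ^+ n) (q ^+ 'C(_, _)) (qpoch _ _ _).
move=> x0 x1 x2 x3 x5 h1 h2 h3 h4.
by field; rewrite h1 h2 h3 h4.
Qed.

Lemma qinvASC_z_expVn n m a b : a != 0 ->
  qinvASC_z n (q ^- m * a) a b q =
  q ^- 'C(n, 2) * (- b) ^+ n * qpoch (a * b)^-1 q n
  * phi31 m (q ^+ m / a ^+ 2) (a * b)^-1 (a / b) (q ^+ n).
Proof.
move=> a0; rewrite /qinvASC_z mulfK //.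
have -> : (a * (q ^- m * a))^-1 = q ^+ m / a ^+ 2.
  by have h := expf_neq0 m q_neq0; field; rewrite a0 h.
(* Truncation uses the parameter [q ^- m] and not [q ^- n], so that the number of terms does not
   depend on [n]. *)
congr (_ * _); rewrite (qhyper_terminating _ _ _ m); last first.
  by rewrite !inE eqxx orbT.
apply: eq_bigr => -[k km] _; rewrite /qhyper_term /qpochs !big_cons !big_nil /=.
rewrite qfall_expn.
have -> : 1 + 1%:Z - 3%:Z = - 1 :> int by [].
by rewrite exprN1 !mulr1 !exprMn; ring.
Qed.

(* The terminating [3phi1] as a [2phi1] in the variable [X]; with [X = q ^+ n]
   the latter is a little q-Jacobi polynomial. *)
Lemma phi31E M B D e X : D != 0 -> e * D * q ^+ M = B * q ->
  qpoch e q M != 0 -> (forall i, (i <= M)%N -> qpoch D q i != 0) ->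
  phi31 M B e (q / D) X =
  q ^- 'C(M, 2) * (- D^-1) ^+ M * (qpoch D q M / qpoch e q M) *
  \sum_(i < M.+1) qpoch (q ^- M) q i * qpoch B q i
    / (qpoch q q i * qpoch D q i) * q ^+ i * X ^+ i.
Proof.
move=> D0 eB e0 Di0.
(* The quotient is a tail of [qpoch e q M]. Read from its last factor, the relation between [e], [D]
   and [B] makes its factors [1 - B / (D q^l)]. *)
have eV j : (j <= M)%N -> qpoch e q M / qpoch e q j
  = q ^- 'C(M - j, 2) * (- D^-1) ^+ (M - j)
    * \prod_(l < M - j) (B - D * q ^+ l).
  move=> jM.
  have -> : qpoch e q M / qpoch e q j = qpoch (e * q ^+ j) q (M - j).
    move: e0; rewrite -{1 2}(subnKC jM) qpochD mulf_eq0 negb_or => /andP[h _].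
    by rewrite mulrAC divff // mul1r.
  rewrite -{1}(subKn jM); move: (M - j)%N (leq_subr j M) => p pM.
  elim: p pM => [|p IHp] pM.
    by rewrite qpoch0 big_ord0 bin0n !expr0 invr1 !mulr1.
  rewrite qpochS big_ord_recr /= -mulrA -exprSr subnSK // IHp 1?ltnW //.
  rewrite binS bin1 exprD exprS.
  have P0 := expf_neq0 p q_neq0.
  have -> : e * q ^+ (M - p.+1) = B / q ^+ p / D.
    have DPq0 : D * q ^+ p * q != 0 by rewrite !mulf_neq0.
    apply: (mulIf DPq0); have -> : B / q ^+ p / D * (D * q ^+ p * q) = B * q.
      by field; rewrite D0 P0.
    rewrite -eB -[in RHS](subnKC pM) exprD exprS; ring.
  have CP0 := expf_neq0 'C(p, 2) q_neq0.
  by field; rewrite D0 P0 CP0.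
have M0 := expf_neq0 'C(M, 2) q_neq0.
have [D1 e1] : qpoch D q M != 0 /\ qpoch e q M != 0 by split=> //; exact: Di0.
(* Once multiplied by [qpoch e q M], the two sides are, up to a constant, those of
   [sum_qbin_qfall]. *)
apply: (mulfI e1).
transitivity ((q ^- 'C(M, 2) * (- D^-1) ^+ M) * \sum_(j < M.+1) qbin _ q M j *
      (qpoch B q j * qfall _ q X j * \prod_(l < M - j) (B - D * q ^+ l))).
  rewrite /phi31 !mulr_sumr; apply: eq_bigr => -[j /=]; rewrite ltnS => jM _.
  have ej : qpoch e q j != 0.
    by move: e1; rewrite -(subnKC jM) qpochD mulf_eq0 negb_or => /andP[].
  transitivity (qpoch (q ^- M) q j / qpoch q q j * qpoch B q j * (q / D) ^+ j
      * qfall _ q X j * (qpoch e q M / qpoch e q j)).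
    by have h := qq_neq0 j; field; rewrite ej h.
  rewrite eV // qpoch_expVn //.
  have -> : (q / D) ^+ j = q ^+ j * D ^- j by rewrite exprMn exprVn.
  have -> : (- D^-1) ^+ M = (-1) ^+ j / D ^+ j * (- D^-1) ^+ (M - j).
    by rewrite -{1}(subnKC jM) exprD (exprNn D^-1 j) exprVn.
  rewrite (bin2_add_sub M j) // !exprD exprM.
  have -> : q ^- M ^+ j = (q ^+ j ^+ j * q ^+ j ^+ (M - j))^-1.
    by rewrite -exprD subnKC // -exprM mulnC exprM exprVn.
  have -> : q ^+ j ^+ j = q ^+ 'C(j, 2) * q ^+ 'C(j, 2) * q ^+ j.
    by rewrite -exprM -!exprD -sqrn_bin2.
  have h1 := qq_neq0 j; have h2 := expf_neq0 'C(j, 2) q_neq0.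
  have h3 := expf_neq0 'C(M - j, 2) q_neq0; have h4 := expf_neq0 j q_neq0.
  have h5 := expf_neq0 (M - j) h4; have h6 := expf_neq0 j D0.
  field; rewrite ?h1 ?h2 ?h3 ?h4 ?h5 ?h6 ?D0 //.
transitivity (q ^- 'C(M, 2) * (- D^-1) ^+ M * q ^- 'C(M, 2) *
  (q ^+ 'C(M, 2) * \sum_(j < M.+1) qbin _ q M j *
      (qpoch B q j * qfall _ q X j * \prod_(l < M - j) (B - D * q ^+ l)))).
  by field; rewrite M0.
rewrite -sum_qbin_qfall //.
rewrite !mulr_sumr; apply: eq_bigr => -[i /=]; rewrite ltnS => iM _.
have Di : qpoch D q i != 0 by exact: Di0.
have -> : qpoch (D * q ^+ i) q (M - i) = qpoch D q M / qpoch D q i.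
  by rewrite -{2}(subnKC iM) qpochD mulrAC divff // mul1r.
rewrite qpoch_expVn //.
have h1 := qq_neq0 i; have h2 := expf_neq0 'C(i, 2) q_neq0.
have h3 := expf_neq0 'C(M - i, 2) q_neq0; have h4 := expf_neq0 i q_neq0.
have h5 := expf_neq0 (M - i) h4.
rewrite (bin2_add_sub M i) // !exprD exprM.
have -> : q ^- M ^+ i = (q ^+ i ^+ i * q ^+ i ^+ (M - i))^-1.
  by rewrite -exprD subnKC // -exprM mulnC exprM exprVn.
have -> : q ^+ i ^+ i = q ^+ 'C(i, 2) * q ^+ 'C(i, 2) * q ^+ i.
  by rewrite -exprM -!exprD -sqrn_bin2.
by field; rewrite ?h1 ?h2 ?h3 ?h4 ?h5 ?Di ?D0 ?e1.
Qed.

End Terminating.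

(** * Convergence of complex sequences *)

Section ComplexSequences.
Variable R : realType.
Local Notation C := (Cplx R).
Local Notation "x %:C" := (real_complex R x : Cplx R)
  (at level 1, format "x %:C").
Implicit Types (u : nat -> C) (K r l B : C).

Lemma norm_real_complex (x : R) : `|x%:C| = `|x|%:C.
Proof. by rewrite normc_def /= expr0n addr0 sqrtr_sqr. Qed.

Lemma cvg_real_complex (v : nat -> R) (x : R) :
  v @ \oo --> x -> (fun n => (v n)%:C) @ \oo --> x%:C.
Proof.
move=> vx; apply/cvgrPdist_lt => e e0.
have eE : e = (complex.Re e)%:C by rewrite RRe_real // gtr0_real.
have e0' : 0 < complex.Re e by move: e0; rewrite eE ltcR.
near=> n; rewrite -rmorphB norm_real_complex eE ltcR.
by near: n; move/cvgrPdist_lt: vx; exact.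
Unshelve. all: by end_near. Qed.

Lemma normr_Re_le (z : C) : `|complex.Re z|%:C <= `|z|.
Proof.
by rewrite normc_def lecR -sqrtr_sqr ler_wsqrtr // lerDl sqr_ge0.
Qed.

Lemma normr_Im_le (z : C) : `|complex.Im z|%:C <= `|z|.
Proof.
by rewrite normc_def lecR -sqrtr_sqr ler_wsqrtr // lerDr sqr_ge0.
Qed.

Lemma is_cvg_geometric_step_real (v : nat -> R) (k r : R) : 0 <= r < 1 ->
  (forall n, `|v n.+1 - v n| <= k * r ^+ n) -> cvgn v.
Proof.
move=> /andP[r0 r1] H.
have : cvgn (series (telescope v)).
  apply: normed_cvg; apply: (@series_le_cvg _ _ (geometric k r)) => //.
  - by move=> n /=.
  - by move=> n /=; exact: le_trans (normr_ge0 _) (H n).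
  - by apply: is_cvg_geometric_series; rewrite ger0_norm.
rewrite telescopeK => vcvg.
have -> : v = (fun n => v n - v 0%N) + cst (v 0%N).
  by apply/funext => n; rewrite fctE /= subrK.
by apply: is_cvgD => //; exact: is_cvg_cst.
Qed.

(** The order on complex numbers is partial, and comparability with 0 forces [K] and [r] to be real.
    Estimates can then be moved to the reals. *)
Lemma geometric_bound_real u K r : 0 <= r < 1 ->
  (forall n, `|u n| <= K * r ^+ n) ->
  exists k s : R, [/\ K = k%:C, r = s%:C, 0 <= k & 0 <= s < 1].
Proof.
move=> /andP[r0 r1] H.
have K0 : 0 <= K.
  by have := le_trans (normr_ge0 _) (H 0%N); rewrite expr0 mulr1.
have KE : K = (complex.Re K)%:C by rewrite RRe_real // ger0_real.
have rE : r = (complex.Re r)%:C by rewrite RRe_real // ger0_real.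
exists (complex.Re K), (complex.Re r); split=> //.
  by move: K0; rewrite KE ler0c.
by move: r0 r1; rewrite rE ler0c ltcR => -> ->.
Qed.

(** Real and imaginary parts inherit the bound on increments, so the real case applies to each. *)
Lemma is_cvg_geometric_step u K r : 0 <= r < 1 ->
  (forall n, `|u n.+1 - u n| <= K * r ^+ n) -> cvgn u.
Proof.
move=> r01 H; have [k [s [KE rE _ s01]]] := geometric_bound_real _ _ _ r01 H.
have HE n : K * r ^+ n = (k * s ^+ n)%:C.
  by rewrite KE rE rmorphM rmorphXn.
have /cvg_ex[x Hx] : cvgn (fun n => complex.Re (u n)).
  apply: (is_cvg_geometric_step_real _ k _ s01) => n.
  by rewrite -lecR -HE -raddfB; apply: le_trans (H n); exact: normr_Re_le.
have /cvg_ex[y Hy] : cvgn (fun n => complex.Im (u n)).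
  apply: (is_cvg_geometric_step_real _ k _ s01) => n.
  by rewrite -lecR -HE -raddfB; apply: le_trans (H n); exact: normr_Im_le.
apply/cvg_ex; exists (x%:C + 'i%C * y%:C).
have -> : u = (fun n => (complex.Re (u n))%:C
                      + ('i%C : C) * (complex.Im (u n))%:C).
  by apply/funext => n; rewrite [LHS]complexE.
apply: cvgD; first exact: cvg_real_complex.
by apply: cvgM; [exact: cvg_cst|exact: cvg_real_complex].
Qed.

(** From [1 + x <= exp x], the partial product is at most the exponential of the partial geometric
    sum [S n], itself at most [k / (1 - s)]. *)
Lemma prod_1Dgeometric_bounded (e : nat -> C) K r : 0 <= r < 1 ->
  (forall n, `|e n| <= K * r ^+ n) ->
  exists B, forall n, `|\prod_(0 <= j < n) (1 + e j)| <= B.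
Proof.
move=> r01 H; have [k [s [KE rE k0]]] := geometric_bound_real _ _ _ r01 H.
move=> /andP[s0 s1]; rewrite {}KE {}rE {r01} in H.
pose S n : R := k * (1 - s ^+ n) / (1 - s).
have HB n : `|\prod_(0 <= j < n) (1 + e j)| <= (expR (S n))%:C.
  elim: n => [|n IHn].
    by rewrite big_geq // normr1 /S expr0 subrr mulr0 mul0r expR0.
  have -> : S n.+1 = S n + k * s ^+ n.
    have s1' : 1 - s != 0 by rewrite subr_eq0 gt_eqF.
    by rewrite /S exprS; field.
  rewrite big_nat_recr //= normrM expRD rmorphM /=.
  apply: ler_pM => //; apply: le_trans (ler_normD _ _) _.
  rewrite normr1; apply: (@le_trans _ _ (1 + k * s ^+ n)%:C).
    by rewrite rmorphD rmorphM rmorphXn /= rmorph1 lerD2l.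
  by rewrite lecR expR_ge1Dx.
exists (expR (k / (1 - s)))%:C => n; apply: le_trans (HB n) _.
rewrite lecR ler_expR /S ler_pM2r ?invr_gt0 ?subr_gt0 //.
by rewrite ler_piMr // lerBlDr lerDl exprn_ge0.
Qed.

(** The increment of the partial product is that product times [e n], hence geometrically small by
    boundedness. *)
Lemma is_cvg_prod_1Dgeometric (e : nat -> C) K r : 0 <= r < 1 ->
  (forall n, `|e n| <= K * r ^+ n) ->
  cvgn (fun n => \prod_(0 <= j < n) (1 + e j)).
Proof.
move=> r01 H; have [B HB] := prod_1Dgeometric_bounded _ _ _ r01 H.
apply: (is_cvg_geometric_step _ (B * K) _ r01) => n.
rewrite big_nat_recr //= mulrDr mulr1 addrAC subrr add0r normrM -mulrA.
exact: ler_pM.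
Qed.

Lemma cvg_norm_le u l B : (forall n, `|u n| <= B) -> u @ \oo --> l -> `|l| <= B.
Proof.
move=> uB ul; rewrite real_leNgt ?ger0_real //; last first.
  exact: le_trans (uB 0%N).
apply/negP => /(cvgr_norm_gt _ ul) [N _ /(_ N (leqnn N))].
by move=> /lt_le_trans/(_ (uB N)); rewrite ltxx.
Qed.

Lemma cvg_geometric_dist u l K r : 0 <= r < 1 ->
  (forall n, `|u n - l| <= K * r ^+ n) -> u @ \oo --> l.
Proof.
move=> r01 H; have [k [s [KE rE k0]]] := geometric_bound_real _ _ _ r01 H.
move=> /andP[s0 s1]; rewrite {}KE {}rE {r01} in H.
have s1' : `|s| < 1 by rewrite ger0_norm.
have /cvgrPdist_lt G := cvg_real_complex _ _ (cvg_geometric k s1').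
apply/cvgrPdist_lt => e /G; apply: filterS => n.
rewrite sub0r normrN /= rmorphM rmorphXn /= => h.
rewrite distrC; apply: le_lt_trans (H n) _; apply: le_lt_trans h.
by rewrite ger0_norm // mulr_ge0 ?exprn_ge0 ?ler0c.
Qed.

End ComplexSequences.

(** * The q-binomial theorem *)

Lemma lim_affine_rec (K : numFieldType) (u v : nat -> K) (l1 l2 A z : K) :
  (forall n, u n.+1 - v n.+1 = z * (u n - A * v n)) ->
  u @ \oo --> l1 -> v @ \oo --> l2 -> (1 - z) * l1 = (1 - A * z) * l2.
Proof.
move=> uv h1 h2.
have L1 : (fun n => u n.+1 - v n.+1) @ \oo --> l1 - l2.
  have h1' : (fun n => u n.+1) @ \oo --> l1 by rewrite (cvg_shiftS u).
  have h2' : (fun n => v n.+1) @ \oo --> l2 by rewrite (cvg_shiftS v).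
  exact: cvgB h1' h2'.
have L2 : (fun n => u n.+1 - v n.+1) @ \oo --> z * (l1 - A * l2).
  under eq_fun do rewrite uv.
  have h3 : (fun n => A * v n) @ \oo --> A * l2 by exact: cvgM (cvg_cst _) h2.
  exact: cvgM (cvg_cst _) (cvgB h1 h3).
have E : l1 - l2 = z * (l1 - A * l2).
  rewrite -(cvg_lim (@norm_hausdorff _ _) L1).
  by rewrite -(cvg_lim (@norm_hausdorff _ _) L2).
have -> : (1 - z) * l1 = l1 - l2 + l2 - z * l1 by ring.
by rewrite E; ring.
Qed.

Lemma cvg_succB (K : numFieldType) (u : nat -> K) (l x : K) :
  u @ \oo --> l -> (fun n => u n.+1 - x) @ \oo --> l - x.
Proof.
move=> ul; have h : (fun n => u n.+1) @ \oo --> l by rewrite (cvg_shiftS u).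
exact: cvgB h (cvg_cst x).
Qed.

(** The bound is linear in [|w|] and uniform in [N]; it gives the limit of the q-binomial series as
    its argument tends to 0. *)
Lemma power_series_dist_le (K : numFieldType) (c : nat -> K) (B r w : K) N :
  (forall n, `|c n| <= B) -> `|w| <= r -> r < 1 -> c 0%N = 1 ->
  `|series (fun n => c n * w ^+ n) N.+1 - 1| <= B * `|w| / (1 - r).
Proof.
move=> cB wr r1 c0.
have r0 : 0 <= r by apply: le_trans wr.
have B0 : 0 <= B by apply: le_trans (cB 0%N).
have r1' : 0 < 1 - r by rewrite subr_gt0.
(* The induction on [N] needs the partial geometric sum, which grows with [N]; the stated bound is
   its upper limit. *)
apply: (@le_trans _ _ (B * `|w| * ((1 - r ^+ N) / (1 - r)))); last first.
  apply: ler_wpM2l; first by rewrite mulr_ge0.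
  by rewrite ler_pdivrMr // mulVf ?gt_eqF // lerBlDr lerDl exprn_ge0.
elim: N => [|N IHN].
  by rewrite /series /= big_nat1 c0 expr0 mulr1 !subrr normr0 mul0r mulr0.
rewrite /series /= big_nat_recr //= addrAC.
apply: le_trans (ler_normD _ _) _.
have -> : (1 - r ^+ N.+1) / (1 - r) = (1 - r ^+ N) / (1 - r) + r ^+ N.
  by rewrite exprS; field; rewrite gt_eqF.
rewrite mulrDr; apply: lerD; first exact: IHN.
rewrite normrM normrX exprS [leRHS](_ : _ = B * (`|w| * r ^+ N)); last by ring.
apply: ler_pM; rewrite ?mulr_ge0 ?exprn_ge0 //.
by apply: ler_wpM2l => //; apply: lerXn2r; rewrite ?nnegrE.
Qed.

Lemma qpoch_iter (K : numClosedFieldType) (q A z : K) (L : K -> K) :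
  (forall n, (1 - z * q ^+ n) * L (z * q ^+ n) =
     (1 - A * z * q ^+ n) * L (z * q ^+ n.+1)) ->
  forall n, qpoch z q n * L z = qpoch (A * z) q n * L (z * q ^+ n).
Proof.
move=> H; elim=> [|n IHn]; first by rewrite !qpoch0 expr0 mulr1.
by rewrite !qpochSr mulrAC IHn -[RHS]mulrA -H; ring.
Qed.

Section QBinomialTheorem.
Variables (R : realType) (q : Cplx R).
Hypothesis q_lt1 : `|q| < 1.
Local Notation C := (Cplx R).
Implicit Types (a x y z A : C).

Let q_ge0_lt1 : 0 <= `|q| < 1. Proof. by rewrite normr_ge0. Qed.

Lemma normrMX_le a j : `|- (a * q ^+ j)| <= `|a| * `|q| ^+ j.
Proof. by rewrite normrN normrM normrX. Qed.

Lemma qpoch_bounded a : exists B, forall n, `|qpoch a q n| <= B.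
Proof.
exact: (prod_1Dgeometric_bounded _ _ _ _ q_ge0_lt1 (normrMX_le a)).
Qed.

Lemma cvg_qpoch a : (qpoch a q n @[n --> \oo]) --> qpoch_infty a q.
Proof.
exact: (is_cvg_prod_1Dgeometric _ _ _ _ q_ge0_lt1 (normrMX_le a)).
Qed.

Lemma qpoch_inftyM a n :
  qpoch_infty a q = qpoch a q n * qpoch_infty (a * q ^+ n) q.
Proof.
apply: cvg_lim; first exact: norm_hausdorff.
rewrite -(cvg_shiftn n) /=.
under eq_fun do rewrite addnC qpochD.
by apply: cvgM; [exact: cvg_cst|exact: cvg_qpoch].
Qed.

(** Splits [(dt/a;q)_oo] into the factor [(dt/a;q)_m] of the prefactor, the factor [(q^m dt/a;q)_i]
    of the [4phi3] and a remainder. *)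
Lemma qpoch_inftyMM a m n : qpoch_infty a q =
  qpoch a q m * qpoch (q ^+ m * a) q n * qpoch_infty (q ^+ m * a * q ^+ n) q.
Proof.
rewrite (qpoch_inftyM a m) (qpoch_inftyM (a * q ^+ m) n) mulrA.
by rewrite (mulrC a).
Qed.

Lemma normr_mulX_lt1 a n : `|a| < 1 -> `|a * q ^+ n| < 1.
Proof.
move=> a1; apply: le_lt_trans a1; rewrite normrM normrX ler_piMr //.
by rewrite exprn_ile1 // ltW.
Qed.

Lemma qpoch_lt1_neq0 a n : `|a| < 1 -> qpoch a q n != 0.
Proof.
move=> a1; apply/qpoch_neq0P => k _.
apply: contraTneq (normr_mulX_lt1 _ k a1) => ->.
by rewrite normr1 ltxx.
Qed.

(** Reciprocal factors are again 1 plus a geometrically small term, so the lemmas on infinite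
    products also cover reciprocals. *)
Let inv_factor a j : `|a| < 1 ->
  (1 - a * q ^+ j)^-1 = 1 + a * q ^+ j / (1 - a * q ^+ j).
Proof.
move=> a1; have h : 1 - a * q ^+ j != 0.
  rewrite subr_eq0 eq_sym; apply: contraTneq (normr_mulX_lt1 _ j a1) => ->.
  by rewrite normr1 ltxx.
by field.
Qed.

Let inv_factor_le a j : `|a| < 1 ->
  `|a * q ^+ j / (1 - a * q ^+ j)| <= `|a| / (1 - `|a|) * `|q| ^+ j.
Proof.
move=> a1; rewrite normrM normfV normrM normrX mulrAC.
apply: ler_wpM2r; first by rewrite exprn_ge0.
apply: ler_wpM2l => //.
have a1' : 0 < 1 - `|a| by rewrite subr_gt0.
have h : 1 - `|a| <= `|1 - a * q ^+ j|.
  apply: le_trans (lerB_dist _ _); rewrite normr1 lerD2l lerN2 normrM normrX.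
  by rewrite ler_piMr // exprn_ile1 // ltW.
by rewrite lef_pV2 // posrE (lt_le_trans a1').
Qed.

Let invr_qpoch a n : `|a| < 1 -> (qpoch a q n)^-1
  = \prod_(0 <= j < n) (1 + a * q ^+ j / (1 - a * q ^+ j)).
Proof.
move=> a1; rewrite /qpoch -prodfV.
by apply: eq_bigr => j _; exact: inv_factor.
Qed.

Lemma qpochV_bounded a : `|a| < 1 ->
  exists B, forall n, `|(qpoch a q n)^-1| <= B.
Proof.
move=> a1; have [B HB] := prod_1Dgeometric_bounded _ _ _ _ q_ge0_lt1
  (fun j => inv_factor_le a j a1).
by exists B => n; rewrite invr_qpoch.
Qed.

(** The reciprocal products converge too. If the product tended to 0, the constant sequence 1 would
    have limit 0. *)
Lemma qpoch_infty_neq0 a : `|a| < 1 -> qpoch_infty a q != 0.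
Proof.
move=> a1; apply/eqP => a0.
have /cvg_ex[l Hl] := is_cvg_prod_1Dgeometric _ _ _ _ q_ge0_lt1
  (fun j => inv_factor_le a j a1).
have : (fun n : nat => 1 : C) @ \oo --> 0 * l.
  have -> : (fun n : nat => 1 : C) = (qpoch a q) \*
      (fun n => \prod_(0 <= j < n) (1 + a * q ^+ j / (1 - a * q ^+ j))).
    by apply/funext => n /=; rewrite -invr_qpoch // mulfV // qpoch_lt1_neq0.
  by have := cvg_qpoch a; rewrite a0 => L0; exact: cvgM L0 Hl.
move=> /(cvg_lim (@norm_hausdorff _ _)).
rewrite (cvg_lim (@norm_hausdorff _ _) (cvg_cst _)) mul0r => /eqP.
by rewrite oner_eq0.
Qed.

(** The sequence of partial sums of [1phi0(A; q, z)]. *)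
Definition qbinser A z := series (fun n => qpoch A q n / qpoch q q n * z ^+ n).

Let coef A n := qpoch A q n / qpoch q q n.

Let coef_bounded A : exists B, forall n, `|coef A n| <= B.
Proof.
have [B HB] := qpoch_bounded A; have [B' HB'] := qpochV_bounded q q_lt1.
by exists (B * B') => n; rewrite normrM; exact: ler_pM.
Qed.

Lemma is_cvg_qbinser A z : `|z| < 1 -> cvgn (qbinser A z).
Proof.
move=> z1; have [B HB] := coef_bounded A.
apply: (is_cvg_geometric_step _ _ B `|z|); first by rewrite normr_ge0.
move=> n; rewrite /qbinser /series /= big_nat_recr //= addrAC subrr add0r.
rewrite normrM normrX; apply: ler_wpM2r; first exact: exprn_ge0.
exact: HB.
Qed.

(** The coefficients [c_n] satisfy [(1 - q^(n+1)) c_(n+1) = (1 - A q^n) c_n]. The relation is exact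
    on partial sums, with one term more on the left. *)
Lemma qbinser_rec A z n :
  qbinser A z n.+1 - qbinser A (z * q) n.+1 =
  z * (qbinser A z n - A * qbinser A (z * q) n).
Proof.
rewrite /qbinser /series /= !big_nat_recl // !expr0 opprD addrACA subrr add0r.
rewrite -sumrB [A * _]mulr_sumr -sumrB mulr_sumr; apply: eq_bigr => i _.
have := qpoch_lt1_neq0 q i.+1 q_lt1.
rewrite !qpochSr mulf_eq0 negb_or => /andP[h1 h2].
by rewrite !exprMn !exprS; field; rewrite h1 h2.
Qed.

Lemma qbinser_lim_rec A z : `|z| < 1 ->
  (1 - z) * limn (qbinser A z) = (1 - A * z) * limn (qbinser A (z * q)).
Proof.
move=> z1; apply: (lim_affine_rec _ (qbinser A z) (qbinser A (z * q)) _ _ _ _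
  (qbinser_rec A z)).
  exact: is_cvg_qbinser.
by apply: is_cvg_qbinser; have := normr_mulX_lt1 z 1 z1; rewrite expr1.
Qed.

Lemma qbinser_lim_iter A z n : `|z| < 1 ->
  qpoch z q n * limn (qbinser A z)
  = qpoch (A * z) q n * limn (qbinser A (z * q ^+ n)).
Proof.
move=> z1; apply: (qpoch_iter _ q A z (fun w => limn (qbinser A w))) => k.
rewrite exprSr mulrA -mulrA; apply: qbinser_lim_rec; exact: normr_mulX_lt1.
Qed.

Lemma cvg_qbinser_lim A z : `|z| < 1 ->
  (fun n => limn (qbinser A (z * q ^+ n))) @ \oo --> (1 : C).
Proof.
move=> z1; have [B HB] := coef_bounded A.
have Hn n : `|limn (qbinser A (z * q ^+ n)) - 1|
    <= B * `|z| / (1 - `|z|) * `|q| ^+ n.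
  have w1 := normr_mulX_lt1 z n z1.
  have wE : `|z * q ^+ n| = `|z| * `|q| ^+ n by rewrite normrM normrX.
  apply: (@cvg_norm_le _ (fun N => qbinser A (z * q ^+ n) N.+1 - 1));
    last first.
    by apply: (cvg_succB _ (qbinser A (z * q ^+ n))); exact: is_cvg_qbinser.
  have -> : B * `|z| / (1 - `|z|) * `|q| ^+ n = B * `|z * q ^+ n| / (1 - `|z|).
    by rewrite wE mulrAC mulrA.
  move=> N; apply: (power_series_dist_le _ (coef A)) => //.
    by rewrite wE ler_piMr // exprn_ile1 // ltW.
  by rewrite /coef !qpoch0 divff // oner_eq0.
exact: (cvg_geometric_dist _ _ _ _ _ q_ge0_lt1 Hn).
Qed.

(** The functional equation between [z] and [z * q] is iterated [n] times; as [n] grows, the value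
    at [z * q^n] tends to 1. *)
Lemma q_binomial A z : `|z| < 1 ->
  qbinser A z @ \oo --> qpoch_infty (A * z) q / qpoch_infty z q.
Proof.
move=> z1; have z0 := qpoch_infty_neq0 z z1.
suff -> : qpoch_infty (A * z) q / qpoch_infty z q = limn (qbinser A z).
  exact: is_cvg_qbinser.
apply: (mulIf z0); rewrite divfK //.
have L1 : (fun n => qpoch z q n * limn (qbinser A z)) @ \oo -->
    qpoch_infty z q * limn (qbinser A z).
  by apply: cvgM; [exact: cvg_qpoch|exact: cvg_cst].
have L2 : (fun n => qpoch z q n * limn (qbinser A z)) @ \oo -->
    qpoch_infty (A * z) q * 1.
  under eq_fun do rewrite qbinser_lim_iter //.
  by apply: cvgM; [exact: cvg_qpoch|exact: cvg_qbinser_lim].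
rewrite [RHS]mulrC -(cvg_lim (@norm_hausdorff _ _) L1).
by rewrite (cvg_lim (@norm_hausdorff _ _) L2) mulr1.
Qed.

End QBinomialTheorem.

(** * The generating function *)

Section SeriesLimits.
Variable K : numFieldType.

Lemma cvg_sum_seq (I : Type) (r : seq I) (f : I -> nat -> K) (l : I -> K) :
  (forall i, f i @ \oo --> l i) ->
  (fun n => \sum_(i <- r) f i n) @ \oo --> \sum_(i <- r) l i.
Proof.
move=> H; elim: r => [|i r IHr].
  rewrite big_nil; under eq_fun do rewrite big_nil.
  exact: cvg_cst.
rewrite big_cons; under eq_fun do rewrite big_cons.
exact: cvgD (H i) IHr.
Qed.

(** Every exchange with the sum over [n] below goes through this lemma, hence involves finitely many
    convergent series. *)
Lemma cvg_series_lincomb N (x : 'I_N -> K) (f : 'I_N -> nat -> K)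
    (l : 'I_N -> K) :
  (forall i, series (f i) @ \oo --> l i) ->
  series (fun n => \sum_(i < N) x i * f i n) @ \oo --> \sum_(i < N) x i * l i.
Proof.
move=> H.
have -> : series (fun n => \sum_(i < N) x i * f i n) =
    (fun n => \sum_(i < N) x i * series (f i) n).
  apply/funext => n; rewrite /series /= exchange_big /=.
  by apply: eq_bigr => i _; rewrite mulr_sumr.
apply: (cvg_sum_seq _ _ (fun i n => x i * series (f i) n)) => i.
exact: cvgM (cvg_cst _) (H i).
Qed.

Lemma cvg_series_shift (f : nat -> K) j (l : K) :
  (forall i, (i < j)%N -> f i = 0) ->
  series (fun n => f (n + j)%N) @ \oo --> l -> series f @ \oo --> l.
Proof.
move=> f0 H; rewrite -(cvg_shiftn j).
suff <- : series (fun n => f (n + j)%N) = (fun n => series f (n + j)%N) by [].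
apply/funext => n; rewrite /series /= addnC.
rewrite [RHS](@big_cat_nat _ _ _ j) ?leq_addr //=.
rewrite [X in _ = X + _]big_nat_cond [X in _ = X + _]big1 ?add0r; last first.
  by move=> i; rewrite andbT => /andP[_ ij]; exact: f0.
by rewrite -{2}[j]add0n big_addn addKn.
Qed.

Lemma cvg_series_eq (f g : nat -> K) (l l' : K) :
  f =1 g -> l = l' -> series f @ \oo --> l -> series g @ \oo --> l'.
Proof. by move=> /funext -> ->. Qed.

End SeriesLimits.

Section FallingFactors.
Variables (C : numClosedFieldType) (q : C).
Hypothesis q_neq0 : q != 0.
Hypothesis qq_neq0 : forall n, qpoch q q n != 0.

Lemma qfallSl (X : C) k : qfall _ q (X * q) k.+1 = (1 - X * q) * qfall _ q X k.
Proof.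
rewrite /qfall big_nat_recl // expr0 invr1 mulr1; congr (_ * _).
apply: eq_bigr => l _; have := expf_neq0 l q_neq0; rewrite exprS => h.
by field; rewrite h q_neq0.
Qed.

Lemma qfall_exprD n k :
  qfall _ q (q ^+ (n + k)) k = qpoch q q (n + k) / qpoch q q n.
Proof.
elim: k => [|k IHk].
  by rewrite addn0 /qfall big_geq // divff.
rewrite addnS exprSr qfallSl IHk qpochSr.
by have h := qq_neq0 n; field.
Qed.

Lemma qfall_expr_small n k : (n < k)%N -> qfall _ q (q ^+ n) k = 0.
Proof. by move=> nk; rewrite qfall_expn // qpoch_expVn_eq0 // !mul0r. Qed.

(** Each factor [1 - x q^-l] with [1 <= l <= m] equals [-x q^-l (1 - q^l / x)]. With [x = a d t]
    this yields the [m]-dependent prefactor of the theorem. *)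
Lemma qpoch_expVn_rev m (x : C) : x != 0 ->
  qpoch (q ^- m * x) q m = q ^- 'C(m, 2) * (- (x / q)) ^+ m * qpoch (q / x) q m.
Proof.
move=> x0; elim: m => [|m IHm].
  by rewrite !qpoch0 bin0n !expr0 invr1 !mulr1.
rewrite qpochS qpochSr.
have -> : q ^- m.+1 * x * q = q ^- m * x.
  by have h := expf_neq0 m q_neq0; rewrite exprS; field; rewrite h q_neq0.
rewrite IHm binS bin1 exprD !exprS.
have h := expf_neq0 m q_neq0; have h' := expf_neq0 'C(m, 2) q_neq0.
by field; rewrite h h' q_neq0 x0.
Qed.

End FallingFactors.

Section Generating.
Variables (R : realType) (q : Cplx R).
Hypothesis q_neq0 : q != 0.
Hypothesis q_lt1 : `|q| < 1.

Let qq_neq0 n : qpoch q q n != 0. Proof. exact: qpoch_lt1_neq0. Qed.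

(** The falling factor kills the terms with [n < k] and otherwise cancels part of [qpoch q q n].
    Shifting [n] by [k] leaves a q-binomial series with parameter [e * q ^+ k]. *)
Lemma cvg_series_qfall (s e : Cplx R) k : `|s| < 1 ->
  series (fun n => s ^+ n * qpoch e q n / qpoch q q n * qfall _ q (q ^+ n) k)
  @ \oo --> s ^+ k * qpoch e q k *
    (qpoch_infty (e * q ^+ k * s) q / qpoch_infty s q).
Proof.
move=> s1; apply: (cvg_series_shift _ _ k) => [i ik|].
  by rewrite qfall_expr_small // mulr0.
(* A combination of one single series, used to pull out the constant. *)
apply: cvg_series_eq (cvg_series_lincomb _ 1 (fun=> s ^+ k * qpoch e q k) _ _
  (fun=> q_binomial _ _ q_lt1 (e * q ^+ k) _ s1)); last by rewrite big_ord1.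
move=> n; rewrite big_ord1 qfall_exprD // exprD [(n + k)%N]addnC qpochD.
have h1 := qq_neq0 (k + n); have h2 := qq_neq0 n.
by field; rewrite h1 h2.
Qed.

(** The two relations on [y] are what make the sum over [k] a case of [q_vandermonde_qpoch]. *)
Lemma cvg_series_phi31 m (s e u B y : Cplx R) : `|s| < 1 ->
  (forall k, qpoch e q k != 0) -> B * y = s * e -> y * q ^+ m = s * u ->
  series (fun n => s ^+ n * qpoch e q n / qpoch q q n
    * phi31 _ q m B e u (q ^+ n)) @ \oo -->
  qpoch_infty (s * e * q ^+ m) q / qpoch_infty s q * qpoch y q m.
Proof.
move=> s1 e0 By yu.
apply: cvg_series_eq (cvg_series_lincomb _ m.+1 (fun k =>
    qpoch (q ^- m) q k * qpoch B q k
    / (qpoch q q k * qpoch e q k) * u ^+ k) _ _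
  (fun k : 'I_m.+1 => cvg_series_qfall s e k s1)).
  move=> n; rewrite /phi31 mulr_sumr; apply: eq_bigr => k _.
  by rewrite mulrCA.
rewrite -(q_vandermonde_qpoch _ q q_neq0 qq_neq0 m B y) mulr_sumr.
apply: eq_bigr => -[k /=]; rewrite ltnS => km _.
(* All [k] share the tail [qpoch_infty (s * e * q ^+ m) q]; what remains is the last factor of the
   Vandermonde summand. *)
have -> : qpoch_infty (e * q ^+ k * s) q =
    qpoch (B * y * q ^+ k) q (m - k) * qpoch_infty (s * e * q ^+ m) q.
  rewrite (qpoch_inftyM _ _ q_lt1 _ (m - k)) -mulrA [q ^+ k * s]mulrC mulrA.
  by rewrite [e * s]mulrC By -[s * e * _ * _]mulrA -exprD subnKC.
rewrite yu exprMn; have h1 := qq_neq0 k; have h2 := e0 k.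
have h3 := qpoch_infty_neq0 _ _ q_lt1 s s1.
by field; rewrite h1 h2 h3.
Qed.

End Generating.

(** * The bilinear sum *)

(** [phi31E] with [D = q d / c] expands the second polynomial. The powers [q^'C(n, 2)], the signs
    and [qpoch (c * d)^-1 q n] cancel, and [q^(n i)] joins [(b d t)^n]. *)
Lemma qinvASC_bilinear_term (C : numClosedFieldType) (q a b c d t : C)
    (m m' n : nat) :
  q != 0 -> (forall k, qpoch q q k != 0) ->
  a != 0 -> b != 0 -> c != 0 -> d != 0 ->
  (forall k, qpoch (c * d)^-1 q k != 0) ->
  (forall k, qpoch (q * d / c) q k != 0) ->
  q ^+ (2 * 'C(n, 2)) * t ^+ n / qpochs [:: q; (c * d)^-1] q n
    * qinvASC_at n (q ^- m * a) a b q
    * qinvASC_at n (q ^- m' * c) c d q =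
  \sum_(i < m'.+1)
    (q ^- 'C(m', 2) * (- (c / (q * d))) ^+ m'
      * (qpoch (q * d / c) q m' / qpoch (c * d)^-1 q m')
      * (qpoch (q ^- m') q i * qpoch (q ^+ m' / c ^+ 2) q i
         / (qpoch q q i * qpoch (q * d / c) q i) * q ^+ i))
    * ((b * d * t * q ^+ i) ^+ n * qpoch (a * b)^-1 q n / qpoch q q n
       * phi31 _ q m (q ^+ m / a ^+ 2) (a * b)^-1 (a / b) (q ^+ n)).
Proof.
move=> q0 qq0 a0 b0 c0 d0 cd0 D0.
have w0 k (x : C) : x != 0 -> q ^- k * x != 0.
  by move=> x0; rewrite mulf_neq0 // invr_eq0 expf_neq0.
rewrite !qinvASC_atE ?w0 // !qinvASC_z_expVn //.
have -> : c / d = q / (q * d / c) by field; rewrite c0 d0 q0.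
rewrite [phi31 _ _ m' _ _ _ _]phi31E //; last 2 first.
- by rewrite !mulf_neq0 ?invr_eq0.
- by field; rewrite c0 d0.
move: (phi31 _ _ _ _ _ _ _) (qpoch (a * b)^-1 q n) => P E.
rewrite !mulr_sumr; apply: eq_bigr => i _.
rewrite /qpochs !big_cons big_nil mulr1.
have -> : - (q * d / c)^-1 = - (c / (q * d))
  by congr (- _); field; rewrite c0 d0 q0.
rewrite mul2n -addnn exprD !exprMn -!exprM [(i * n)%N]mulnC.
rewrite [(- b) ^+ n]exprNn [(- d) ^+ n]exprNn.
have hs : (-1) ^+ n * (-1) ^+ n = 1 :> C by rewrite -expr2 sqrr_sign.
have h1 := qq0 n; have h2 := cd0 n; have h3 := cd0 m'.
have h4 := expf_neq0 'C(n, 2) q0.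
have h5 := qq0 i; have h6 := D0 i; have h7 := expf_neq0 'C(m', 2) q0.
rewrite -[RHS]mul1r -[X in _ = X * _]hs.
move: ((- (c / (q * d))) ^+ m') => W.
move: ((-1) ^+ n) hs => s hs.
move: (qpoch _ _ n) h1 => x1 h1; move: (qpoch _ _ n) h2 => x2 h2.
move: (q ^+ 'C(n, 2)) (q ^+ 'C(m', 2)) h4 h7 => x4 x7 h4 h7.
move: (qpoch (c * d)^-1 q m') h3 => x3 h3.
move: (qpoch q q i) h5 => x5 h5; move: (qpoch (q * d / c) q i) h6 => x6 h6.
move: (qpoch _ _ _) (qpoch _ _ _) (qpoch _ _ _) (q ^+ i)
  (q ^+ (n * i)) (b ^+ n) (d ^+ n).
move=> y1 y2 y3 y4 y5 y6 y7.
by field; rewrite h1 h2 h3 h4 h5 h6 h7.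
Qed.

(** The comparison of the [i]-th summands with all products abstracted: the [P] are the three pieces
    of [(dt/a;q)_oo], the [Y] are products based at [q^-m a d t] and its shift by [q^i]. *)
Lemma bilinear_coef_eq (K : fieldType)
    (G W r A B Q D X g V Z Pm Pi Pinf Ym Yi Yim Ai bi binf : K) :
  Pm != 0 -> Pi != 0 -> Yi != 0 -> bi != 0 -> binf != 0 -> Q != 0 -> D != 0 ->
  Ym = g * V * Z -> Ym * Ai = Yi * Yim ->
  G * W * r * (A * B / (Q * D) * X) * (Pinf / binf * Yim) =
  g * G * W * V * (Pm * Pi * Pinf / (bi * binf)) * (Z / Pm) * r
    * (A * (B * (Ai * bi)) / (Q * (Yi * (Pi * D))) * X).
Proof.
move=> h1 h2 h3 h4 h5 h6 h7 YmE hY.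
have -> : Yim = g * V * Z * Ai / Yi by rewrite -YmE hY mulrAC divff // mul1r.
by field; rewrite h1 h2 h3 h4 h5 h6 h7.
Qed.

(** Stated as convergence of the partial sums, since an equation with [limn] would not by itself
    assert that the series converges. *)
Theorem theorem4p1 (R : realType) (m m' : nat) (q a b c d t : Cplx R)
  (q_gt0 : 0 < `|q|) (q_lt1 : `|q| < 1)
  (a_neq0 : a != 0) (b_neq0 : b != 0) (c_neq0 : c != 0) (d_neq0 : d != 0)
  (bdt_lt1 : `|b * d * t| < 1)
  (* no denominator vanishes: *)
  (t_neq0 : t != 0)
  (ab_ok : qhyper_lower_ok q (a * b)^-1)
  (cd_ok : qhyper_lower_ok q (c * d)^-1)
  (dta_neq0 : qpoch (d * t / a) q m != 0)
  (adt_ok : qhyper_lower_ok q (q ^- m * (a * d * t)))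
  (dta_ok : qhyper_lower_ok q (q ^+ m * (d * t / a)))
  (qdc_ok : qhyper_lower_ok q (q * d / c)) :
  series (fun n : nat =>
    q ^+ (2 * 'C(n, 2)) * t ^+ n / qpochs [:: q; (c * d)^-1] q n
    * qinvASC_at n (q ^- m * a) a b q
    * qinvASC_at n (q ^- m' * c) c d q) @ \oo -->
  q ^- 'C(m, 2) * q ^- 'C(m', 2)
  * (- (c / (q * d))) ^+ m' * (- (a * d * t / q)) ^+ m
  * (qpoch_infty (d * t / a) q / qpoch_infty (b * d * t) q)
  * (qpoch (q / (a * d * t)) q m / qpoch (d * t / a) q m)
  * (qpoch (q * d / c) q m' / qpoch (c * d)^-1 q m')
  * qhyper [:: q ^- m'; q ^+ m' / c ^+ 2; a * d * t; b * d * t]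
           [:: q ^- m * (a * d * t); q ^+ m * (d * t / a); q * d / c] q q.
Proof.
have q0 : q != 0 by rewrite -normr_gt0.
have qq0 k : qpoch q q k != 0 by exact: qpoch_lt1_neq0.
have e0 := qpoch_lower_ok_neq0 _ _ _ q0 ab_ok.
have e0' := qpoch_lower_ok_neq0 _ _ _ q0 cd_ok.
have D0 := qpoch_lower_ok_neq0 _ _ _ q0 qdc_ok.
have Y0 := qpoch_lower_ok_neq0 _ _ _ q0 adt_ok.
have P0 := qpoch_lower_ok_neq0 _ _ _ q0 dta_ok.
have m0 := expf_neq0 m q0.
(* The generating function at [t q^i]: here [s = b d t q^i] and [y = q^-m a d t q^i]. *)
have L i : series (fun n => (b * d * t * q ^+ i) ^+ n * qpoch (a * b)^-1 q n
      / qpoch q q n * phi31 _ q m (q ^+ m / a ^+ 2) (a * b)^-1 (a / b) (q ^+ n))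
    @ \oo --> qpoch_infty (q ^+ m * (d * t / a) * q ^+ i) q
      / qpoch_infty (b * d * t * q ^+ i) q
      * qpoch (q ^- m * (a * d * t) * q ^+ i) q m.
  have <- : b * d * t * q ^+ i * (a * b)^-1 * q ^+ m
      = q ^+ m * (d * t / a) * q ^+ i.
    by field; rewrite a_neq0 b_neq0.
  apply: cvg_series_phi31 => //.
  - exact: (normr_mulX_lt1 _ _ q_lt1).
  - by field; rewrite m0 a_neq0 b_neq0.
  - by field; rewrite m0 b_neq0.
apply: cvg_series_eq (cvg_series_lincomb _ m'.+1 (fun i =>
    q ^- 'C(m', 2) * (- (c / (q * d))) ^+ m'
      * (qpoch (q * d / c) q m' / qpoch (c * d)^-1 q m')
      * (qpoch (q ^- m') q i * qpoch (q ^+ m' / c ^+ 2) q i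
         / (qpoch q q i * qpoch (q * d / c) q i) * q ^+ i)) _ _ L).
  by move=> n; rewrite qinvASC_bilinear_term.
rewrite (qhyper_terminating _ _ q0 _ _ _ m') ?inE ?eqxx //.
rewrite mulr_sumr; apply: eq_bigr => i _.
rewrite /qhyper_term /qpochs !big_cons !big_nil /= expr0z !mulr1.
have adt0 : a * d * t != 0 by rewrite !mulf_neq0.
rewrite (qpoch_inftyMM _ _ q_lt1 (d * t / a) m i).
rewrite (qpoch_inftyM _ _ q_lt1 (b * d * t) i).
(* Both sides are [qpoch (q ^- m * (a * d * t)) q (m + i)], split at [m] and at [i]. *)
have hY : qpoch (q ^- m * (a * d * t)) q m * qpoch (a * d * t) q i =
    qpoch (q ^- m * (a * d * t)) q i
    * qpoch (q ^- m * (a * d * t) * q ^+ i) q m.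
  by rewrite -qpochD addnC qpochD; congr (_ * qpoch _ _ _); field.
apply: bilinear_coef_eq hY => //; last exact: qpoch_expVn_rev.
  exact: qpoch_lt1_neq0.
by apply: qpoch_infty_neq0 => //; exact: normr_mulX_lt1.
Qed.
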